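(* In type $(A_{n-1},j)$, the set of all rectangular $\Gamma$-moves $(x,y,S_0)$ — where $x<y$ are boxes of an order ideal $O\subseteq Q$ such that $[x,y]$ has at least two rows and two columns, and $S_0$ fills $(x,y)$ with $+$ at the box in the row of $y$ and column of $x$ and at the box in the row of $x$ and column of $y$ and with $0$ elsewhere — is a complete set of $\Gamma$-moves.
   Context: $W=S_n$ with simple reflections $s_i=(i,i+1)$, length $\ell$, Bruhat order $<$. $Q$: boxes $(r,c)$, $1\le r\le j$ (rows top to bottom), $1\le c\le n-j$, label $s_{(r,c)}=s_{r+c-1}$; order = transitive closure of $(r,c)\lessdot(r,c+1)$, $(r,c)\lessdot(r-1,c)$; order ideals are down-closed subsets. For a convex subset $C$ (closed under betweenness) and $D:C\to\{0,+\}$ (an $\oplus$-diagram), with a linear extension $b_1,\dots,b_m$ of $C$, put $t_k=s_{b_k}$ if $D(b_k)=0$, $t_k=1$ if $D(b_k)=+$, and $v(D)=t_m\cdots t_1$. For $C=O$ an order ideal, $D$ is a $\Gamma$-diagram if, writing $s_{i_k}:=s_{b_{m+1-k}}$ and $v_{(k)}=t_m t_{m-1}\cdots t_{m+1-k}$ ($v_{(0)}=1$), one has $v_{(k-1)}<v_{(k-1)}s_{i_k}$ for all $k$ (independent of the linear extension). Every $\oplus$-diagram $D$ of shape $O$ has a unique $\Gamma$-diagram $D_+$ of shape $O$ with $v(D_+)=v(D)$. Intervals: $(x,y)=\{z:x<z<y\}$ etc. $D$ of shape $(x,y)$ is compatible with $S:(x,y)\to\{0,+,?\}$ if $D(z)=S(z)$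 whenever $S(z)\neq ?$. A $\Gamma$-move is a triple $(x,y,S)$, $x<y$, such that $v(D\cup x)=v(D\cup y)$ for all $D$ compatible with $S$ ($D\cup x$, $D\cup y$ extend $D$ by a $0$ at $x$, resp. $y$). A move $(x,y,S)$ can be performed on a diagram $D$ of shape $O\supseteq[x,y]$ if $D(y)=0$ and $D|_{(x,y)}$ is compatible with $S$; the result $D'$ has $D'(y)=+$, $D'(x)$ the opposite symbol of $D(x)$, and agrees with $D$ elsewhere. A set $M$ of $\Gamma$-moves is complete if every $\oplus$-diagram $D$ can be transformed into $D_+$ by a finite sequence of moves from $M$. *)

(* Defs.v *)
From mathcomp Require Import all_boot all_fingroup.
From mathcomp Require Import zify.
From Stdlib Require Import Relation_Operators.

Set Implicit Arguments.
Unset Strict Implicit.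
Unset Printing Implicit Defensive.

Import GroupScope.

(** ** S_n as a Coxeter group *)

(* Positions are 0-based: the simple reflection s_i = (i, i+1), 1 <= i <= n-1,
   exchanges the ordinals i-1 and i.  MathComp multiplies permutations from
   left to right; w |-> w^-1 is an isomorphism to the other convention that
   fixes every reflection, so the convention does not affect what follows. *)
Definition simple_refls (n : nat) : {set 'S_n} :=
  [set w | [exists i : 'I_n, exists k : 'I_n,
             (i.+1 == k :> nat) && (w == tperm i k)]].

Definition reflections (n : nat) : {set 'S_n} :=
  class_support (simple_refls n) [set: 'S_n].

Definition has_word (n : nat) (w : 'S_n) (k : nat) : bool :=
  [exists t : k.-tuple 'S_n,
    all (fun s => s \in simple_refls n) t && (w == \prod_(s <- t) s)].

Lemma simple_refls_tperm (n : nat) (a b : 'I_n) :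
  a < b -> tperm a b \in <<simple_refls n>>.
Proof.
have [d] := ubnP (b - a); elim: d b => // d IHd b le_d lt_ab.
have [eq_ab | ne_ab] := eqVneq a.+1 (b : nat).
  apply: mem_gen; rewrite inE; apply/existsP; exists a; apply/existsP; exists b.
  by rewrite eq_ab !eqxx.
have lt_b' : b.-1 < n by have := ltn_ord b; lia.
pose b' := Ordinal lt_b'.
have lt_ab' : a < b' by rewrite /=; lia.
have Hab' : tperm a b' \in <<simple_refls n>> by apply: IHd; rewrite /=; lia.
have Hb'b : tperm b' b \in <<simple_refls n>>.
  apply: mem_gen; rewrite inE; apply/existsP; exists b'; apply/existsP; exists b.
  by rewrite eqxx andbT; apply/eqP; rewrite /=; lia.
have <- : tperm a b' ^ tperm b' b = tperm a b.
  rewrite tpermJ tpermL tpermD //; apply/eqP => /(congr1 val) /=; lia.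
by rewrite groupJ.
Qed.

Lemma has_word_ex (n : nat) (w : 'S_n) : exists k, has_word w k.
Proof.
have : w \in <<simple_refls n>>.
  have [ts -> _] := prod_tpermP w.
  apply: group_prod => -[a b] _ /=.
  have [lt_ab | lt_ba | /val_inj ->] := ltngtP a b.
  - exact: simple_refls_tperm.
  - by rewrite tpermC simple_refls_tperm.
  - by rewrite tperm1 group1.
case/gen_prodgP => k [c Sc ->]; exists k.
apply/existsP; exists [tuple c i | i < k]; apply/andP; split.
  by apply/allP => s /mapP[i _ ->].
by rewrite big_tuple; apply/eqP; apply: eq_bigr => i _; rewrite tnth_mktuple.
Qed.

Definition coxlen (n : nat) (w : 'S_n) : nat := ex_minn (has_word_ex w).

Definition bruhat_step (n : nat) : rel 'S_n :=
  fun u w => [exists t in reflections n, w == u * t] && (coxlen u < coxlen w).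

Definition bruhat_lt (n : nat) (u w : 'S_n) : bool :=
  (u != w) && connect (@bruhat_step n) u w.

(** ** The rectangle Q *)

(* The box (r, c) of Q is the pair of ordinals (r-1, c-1). *)
Definition box (n j : nat) : finType := ('I_j * 'I_(n - j))%type.

Definition cover (n j : nat) : rel (box n j) := fun a b =>
  ((b.1 == a.1) && (b.2 == a.2.+1 :> nat)) ||
  ((b.1.+1 == a.1 :> nat) && (b.2 == a.2)).

Definition qle (n j : nat) : rel (box n j) := connect (@cover n j).
Definition qlt (n j : nat) : rel (box n j) := fun a b => (a != b) && qle a b.

Lemma box_label_lt (n j : nat) (b : box n j) : (b.1 + b.2).+1 < n.
Proof. by case: b => r c /=; have := ltn_ord r; have := ltn_ord c; lia. Qed.

(* s_{r+c-1} = (r+c-1, r+c) exchanges the 0-based positions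
   (r-1)+(c-1) and (r-1)+(c-1)+1. *)
Definition box_refl (n j : nat) (b : box n j) : 'S_n :=
  tperm (Ordinal (ltnW (box_label_lt b))) (Ordinal (box_label_lt b)).

Definition order_ideal (n j : nat) (O : {set box n j}) : Prop :=
  forall a b, qle a b -> b \in O -> a \in O.

Definition itv_oo (n j : nat) (x y : box n j) : {set box n j} :=
  [set z | qlt x z && qlt z y].
Definition itv_co (n j : nat) (x y : box n j) : {set box n j} :=
  [set z | qle x z && qlt z y].
Definition itv_oc (n j : nat) (x y : box n j) : {set box n j} :=
  [set z | qlt x z && qle z y].
Definition itv_cc (n j : nat) (x y : box n j) : {set box n j} :=
  [set z | qle x z && qle z y].

Definition lin_ext (n j : nat) (C : {set box n j}) (bs : seq (box n j)) : Prop :=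
  [/\ uniq bs, bs =i C &
      {in C &, forall a b, qlt a b -> index a bs < index b bs}].

Lemma lin_ext_ex (n j : nat) (C : {set box n j}) : exists bs, lin_ext C bs.
Proof.
pose key (b : box n j) := j - b.1 + b.2.
have key_cover a b : cover a b -> key a < key b.
  rewrite /key; case: a b => [r c] [r' c'] /=.
  rewrite /cover /= => /orP[/andP[/eqP-> /eqP->] | /andP[/eqP h /eqP->]]; first lia.
  have := ltn_ord r; lia.
have key_lt a b : qlt a b -> key a < key b.
  case/andP=> ne_ab /connectP[p]; elim: p a ne_ab => [a | c p IHp a _] /=.
    by move=> ne_ab _ eq_ba; rewrite eq_ba eqxx in ne_ab.
  case/andP=> /key_cover lt_ac path_p def_b.
  have [<- // | ne_cb] := eqVneq c b.
  exact: ltn_trans lt_ac (IHp c ne_cb path_p def_b).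
pose le_key := [rel a b | key a <= key b].
exists (sort le_key (enum C)); split.
- by rewrite sort_uniq enum_uniq.
- by move=> b; rewrite mem_sort mem_enum.
move=> a b Ca Cb /key_lt lt_ab; rewrite ltnNge; apply/negP => le_ba.
have tr : transitive le_key by move=> u v w; apply: leq_trans.
have rf : reflexive le_key by move=> u; apply: leqnn.
have st : sorted le_key (sort le_key (enum C)).
  by apply: sort_sorted => u v; apply: leq_total.
have := sorted_leq_index tr rf st.
move=> /(_ b a); rewrite !mem_sort !mem_enum => /(_ Cb Ca le_ba) /=.
by rewrite leqNgt lt_ab.
Qed.

(** ** Diagrams *)

Inductive symbol : Type := Zero | Plus.

Definition opp_symbol (s : symbol) : symbol :=
  if s is Zero then Plus else Zero.

(* A filling C -> symbol is a partial function on the boxes of Q whose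
   domain of definition is exactly C; [None] means "not a box of C". *)
Definition filling (n j : nat) : Type := {ffun box n j -> option symbol}.

Definition has_shape (n j : nat) (T : Type) (C : {set box n j})
    (F : box n j -> option T) : Prop :=
  forall b, isSome (F b) = (b \in C).

Definition restrict (n j : nat) (C : {set box n j}) (D : filling n j) :
    filling n j :=
  [ffun b => if b \in C then D b else None].

Definition add_zero (n j : nat) (D : filling n j) (x : box n j) : filling n j :=
  [ffun b => if b == x then Some Zero else D b].

Definition factor (n j : nat) (D : filling n j) (b : box n j) : 'S_n :=
  if D b is Some Zero then box_refl b else 1.

(* For bs = [:: b_1; ...; b_m] this is t_m * ... * t_1. *)
Definition vprod (n j : nat) (D : filling n j) (bs : seq (box n j)) : 'S_n :=
  \prod_(b <- rev bs) factor D b.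

(* In the condition, p = [:: b_m; ...; b_(m+2-k)] and b = b_(m+1-k), so that
   the product over p is v_(k-1) and [box_refl b] is s_(i_k). *)
Definition Gamma_diagram (n j : nat) (O : {set box n j}) (D : filling n j) :
    Prop :=
  has_shape O D /\
  forall bs, lin_ext O bs ->
  forall p b q, rev bs = p ++ b :: q ->
    bruhat_lt (\prod_(a <- p) factor D a)
              ((\prod_(a <- p) factor D a) * box_refl b).

Definition is_plus_of (n j : nat) (O : {set box n j}) (D Dp : filling n j) :
    Prop :=
  Gamma_diagram O Dp /\
  forall bs, lin_ext O bs -> vprod Dp bs = vprod D bs.

(** ** Moves *)

(* [Any] is the symbol "?". *)
Inductive pattern_symbol : Type := Fixed of symbol | Any.

Record move (n j : nat) : Type := Move {
  mv_x : box n j;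
  mv_y : box n j;
  mv_pat : box n j -> option pattern_symbol
}.

Definition compatible (n j : nat) (D : filling n j)
    (pat : box n j -> option pattern_symbol) : Prop :=
  forall z s, pat z = Some (Fixed s) -> D z = Some s.

Definition Gamma_move (n j : nat) (m : move n j) : Prop :=
  let: Move x y pat := m in
  [/\ qlt x y,
      has_shape (itv_oo x y) pat &
      forall D : filling n j,
        has_shape (itv_oo x y) D -> compatible D pat ->
      forall cx cy, lin_ext (itv_co x y) cx -> lin_ext (itv_oc x y) cy ->
        vprod (add_zero D x) cx = vprod (add_zero D y) cy].

Definition can_perform (n j : nat) (O : {set box n j}) (m : move n j)
    (D : filling n j) : Prop :=
  let: Move x y pat := m in
  [/\ itv_cc x y \subset O,
      D y = Some Zero &
      compatible (restrict (itv_oo x y) D) pat].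

Definition perform (n j : nat) (m : move n j) (D : filling n j) : filling n j :=
  let: Move x y _ := m in
  [ffun b => if b == y then Some Plus
             else if b == x then omap opp_symbol (D x)
             else D b].

Definition move_step (n j : nat) (M : move n j -> Prop) (O : {set box n j})
    (D D' : filling n j) : Prop :=
  exists m, [/\ M m, can_perform O m D & D' = perform m D].

Definition complete (n j : nat) (M : move n j -> Prop) : Prop :=
  forall (O : {set box n j}) (D : filling n j),
    order_ideal O -> has_shape O D ->
  exists Dp : filling n j,
    unique (is_plus_of O D) Dp /\
    clos_refl_trans (filling n j) (move_step M O) D Dp.

Definition complete_set_of_Gamma_moves (n j : nat) (M : move n j -> Prop) :
    Prop :=
  (forall m, M m -> Gamma_move m) /\ complete M.

(** ** Rectangular moves *)

Definition rect_pattern (n j : nat) (x y : box n j) :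
    box n j -> option pattern_symbol := fun z =>
  if z \in itv_oo x y then
    Some (Fixed (if (z == (y.1, x.2)) || (z == (x.1, y.2)) then Plus else Zero))
  else None.

Definition rectangular (n j : nat) (m : move n j) : Prop :=
  exists (O : {set box n j}) (x y : box n j),
    [/\ order_ideal O, x \in O, y \in O & qlt x y] /\
    [/\ 1 < #|[set b.1 | b in itv_cc x y]|,
        1 < #|[set b.2 | b in itv_cc x y]| &
        m = Move x y (rect_pattern x y)].

(* Main.v *)
Require Import Defs.
From mathcomp Require Import all_boot all_fingroup.
From mathcomp Require Import zify.
From Stdlib Require Import Relation_Operators.

(* Read a diagram as a wiring diagram: wires enter along the upper right
   boundary of O and travel left and down, crossing in a 0 and turning in
   a +. It is a Gamma-diagram iff wires that have crossed never meet again.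

   If two wires cross in y and meet again, the one leaving y to the left must
   turn down at a + in the row of y, and the other must turn left at a + in the
   column of y. Hence a diagram in which no 0 has both a + to its left and
   a + below it is a Gamma-diagram. If some 0 has both, then the smallest
   rectangle spanned by such a configuration carries a rectangular move.

   In a rectangular move, the wires leaving y reach x after turning only in the
   two other corners, so s_y u = u s_x for the product u of the factors between
   y and x; thus the move preserves v(D). It replaces a 0 in y by at most
   one 0 in the smaller box x, so performing moves terminates. A Gamma-diagram
   is recovered greedily from v, which gives uniqueness. *)

Set Implicit Arguments.
Unset Strict Implicit.
Unset Printing Implicit Defensive.

Import GroupScope.

(** * Length and inversions *)

Section Length.
Variable n : nat.
Implicit Types (w u : 'S_n) (i k : 'I_n).

Definition inversions w : {set 'I_n * 'I_n} :=
  [set p : 'I_n * 'I_n | (p.1 < p.2) && (w p.2 < w p.1)].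

Lemma tperm_adj_lt i k (x y : 'I_n) : i.+1 = k -> x != y ->
  ~~ ((x == i) && (y == k)) -> ~~ ((x == k) && (y == i)) ->
  (tperm i k x < tperm i k y) = (x < y).
Proof.
rewrite -!val_eqE /= => ik.
by case: tpermP => [->|->|/eqP + /eqP]; case: tpermP => [->|->|/eqP + /eqP];
  rewrite -?val_eqE /=; lia.
Qed.

(** Products apply [w] first, so the right factor exchanges the values i and k. The only pair of
    positions whose order changes is the pair holding these two values. *)
Lemma inversions_asc w i k : i.+1 = k -> w^-1 i < w^-1 k ->
  #|inversions (w * tperm i k)| = #|inversions w|.+1.
Proof.
move=> ik lt_ik.
have -> : inversions (w * tperm i k) = (w^-1 i, w^-1 k) |: inversions w.
  apply/setP => -[a b]; rewrite !inE !permM /=.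
  have [[-> ->] | ne] := eqVneq (a, b) (w^-1 i, w^-1 k).
    by rewrite !permKV tpermL tpermR lt_ik ik /=; lia.
  have [lt_ab /= | //] := ltnP a b.
  apply: tperm_adj_lt => //.
  - by rewrite (inj_eq perm_inj) -val_eqE /=; lia.
  - apply/negP => /andP[/eqP wb /eqP wa]; move: lt_ik.
    by rewrite -wa -wb !permK; lia.
  apply/negP => /andP[/eqP wb /eqP wa]; move: ne.
  by rewrite -wa -wb !permK eqxx.
by rewrite cardsU1 !inE /= !permKV -ik; lia.
Qed.

Lemma inversions_desc w i k : i.+1 = k -> w^-1 k < w^-1 i ->
  #|inversions w| = #|inversions (w * tperm i k)|.+1.
Proof.
move=> ik lt_ki; rewrite -(@inversions_asc (w * tperm i k) i k ik).
  by rewrite -mulgA tperm2 mulg1.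
by rewrite invMg tpermV !permM tpermL tpermR.
Qed.

Lemma inversions_mul_le w i k : i.+1 = k ->
  #|inversions (w * tperm i k)| <= #|inversions w|.+1.
Proof.
move=> ik; have [lt|gt|/val_inj/perm_inj eq_ik] := ltngtP (w^-1 i) (w^-1 k).
- by rewrite inversions_asc.
- by rewrite (inversions_desc ik gt) ltnW // ltnW.
- by move: ik; rewrite eq_ik; lia.
Qed.

Lemma simple_reflsP s :
  reflect (exists i k : 'I_n, i.+1 = k /\ s = tperm i k) (s \in simple_refls n).
Proof.
rewrite inE; apply: (iffP existsP) => [[i /existsP[k /andP[/eqP ik /eqP ->]]] | ].
  by exists i, k.
by case=> i [k [ik ->]]; exists i; apply/existsP; exists k; rewrite ik !eqxx.
Qed.

Lemma has_word_inversions w (m : nat) : has_word w m -> #|inversions w| <= m.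
Proof.
case/existsP=> -[t /= /eqP <-] /andP[/allP t_simple /eqP ->].
elim/last_ind: t t_simple => [_ | t s IHt t_simple].
  rewrite big_nil leqn0 cards_eq0; apply/eqP/setP => -[a b].
  by rewrite !inE !perm1 /=; lia.
rewrite big_rcons size_rcons /=.
have /simple_reflsP[i [k' [ik ->]]] : s \in simple_refls n.
  by apply: t_simple; rewrite mem_rcons mem_head.
apply: leq_trans (inversions_mul_le _ ik) _.
by apply: IHt => z tz; apply: t_simple; rewrite mem_rcons inE tz orbT.
Qed.

(** Without descents [w^-1] is strictly increasing, and a strictly increasing self-map of a finite
    interval is the identity. *)
Lemma no_descent_id w :
  (forall i k, i.+1 = k -> w^-1 i < w^-1 k) -> w = 1.
Proof.
move=> asc; apply/invg_inj; rewrite invg1; apply/permP => i; rewrite perm1.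
set v := w^-1 in asc *.
have mono (a b : 'I_n) : a < b -> v a < v b.
  have [d] := ubnP (b - a); elim: d b => // d IHd b le_d lt_ab.
  have [eq_ab | ne_ab] := eqVneq a.+1 (b : nat); first exact: asc.
  have lt_b' : b.-1 < n by have := ltn_ord b; lia.
  apply: ltn_trans (IHd (Ordinal lt_b') _ _) (asc _ _ _) => /=; lia.
(* Induction from the bottom gives a <= v a; [ge'] below is the induction from the top and amounts
   to v a <= a. *)
have ge (a : 'I_n) : a <= v a.
  have [d] := ubnP (a : nat); elim: d a => // d IHd a le_d.
  case a_eq: (a : nat) => [// | c].
  have lt_c : c < n by have := ltn_ord a; lia.
  have := IHd (Ordinal lt_c); have := mono (Ordinal lt_c) a; rewrite /=; lia.
have ge' (a : 'I_n) : n - a <= n - v a.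
  have [d] := ubnP (n - a); elim: d a => // d IHd a le_d.
  have [lt_c | ] := ltnP a.+1 n; last by have := ltn_ord (v a); lia.
  have := IHd (Ordinal lt_c); have := mono a (Ordinal lt_c).
  have := ltn_ord (v (Ordinal lt_c)); rewrite /=; lia.
by apply/val_inj => /=; have := ge i; have := ge' i; have := ltn_ord (v i); lia.
Qed.

Lemma inversions_has_word w : has_word w #|inversions w|.
Proof.
move: {-1}#|_| (erefl #|inversions w|) => m.
elim: m w => [|m IHm] w w_m.
  have -> : w = 1.
    apply: no_descent_id => i k ik.
    have [//|gt|/val_inj/perm_inj eq_ik] := ltngtP (w^-1 i) (w^-1 k).
      by move: w_m; rewrite (inversions_desc ik gt).
    by move: ik; rewrite eq_ik; lia.
  by apply/existsP; exists [tuple]; rewrite big_nil eqxx.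
have [/existsP[i /existsP[k /andP[/eqP ik gt]]] | no_desc] :=
  boolP [exists i : 'I_n, exists k : 'I_n,
           (i.+1 == k :> nat) && (w^-1 k < w^-1 i)].
  have := inversions_desc ik gt; rewrite w_m => -[/esym/IHm].
  case/existsP=> t /andP[t_simple /eqP wt].
  apply/existsP; exists [tuple of rcons t (tperm i k)].
  rewrite all_rcons t_simple andbT big_rcons /= -wt -mulgA tperm2 mulg1 eqxx andbT.
  by apply/simple_reflsP; exists i, k.
have w1 : w = 1.
  apply: no_descent_id => i k ik.
  have [//|gt|/val_inj/perm_inj eq_ik] := ltngtP (w^-1 i) (w^-1 k).
    case/negP: no_desc; apply/existsP; exists i; apply/existsP; exists k.
    by rewrite ik eqxx.
  by move: ik; rewrite eq_ik; lia.
(* The empty word spells w, so w has no inversions, against [m.+1]. *)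
have : has_word w 0 by apply/existsP; exists [tuple]; rewrite w1 big_nil eqxx.
by move/has_word_inversions; rewrite w_m.
Qed.

Lemma coxlenE w : coxlen w = #|inversions w|.
Proof.
rewrite /coxlen; case: ex_minnP => k /has_word_inversions le_k min_k.
by apply/eqP; rewrite eqn_leq le_k min_k // inversions_has_word.
Qed.

Lemma bruhat_lt_coxlen u w : bruhat_lt u w -> coxlen u < coxlen w.
Proof.
case/andP=> ne_uw /connectP[p]; elim: p u ne_uw => [u | v p IHp u _] /=.
  by move=> ne_uw _ eq_wu; rewrite eq_wu eqxx in ne_uw.
case/andP=> /andP[_ lt_uv] path_p def_w.
have [<- // | ne_vw] := eqVneq v w.
exact: ltn_trans lt_uv (IHp v ne_vw path_p def_w).
Qed.

(** An ascent is a single Bruhat step. With [bruhat_lt_coxlen] this links the Gamma condition to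
    lengths in both directions. *)
Lemma bruhat_lt_asc u i k : i.+1 = k -> u^-1 i < u^-1 k ->
  bruhat_lt u (u * tperm i k).
Proof.
move=> ik lt_ik.
have lt_len : coxlen u < coxlen (u * tperm i k).
  by rewrite !coxlenE inversions_asc.
apply/andP; split; first by apply: contraTneq lt_len => <-; rewrite ltnn.
apply: connect1; rewrite /bruhat_step lt_len andbT.
apply/existsP; exists (tperm i k); rewrite eqxx andbT.
apply/imset2P; exists (tperm i k) 1; rewrite ?conjg1 ?in_setT //.
by apply/simple_reflsP; exists i, k.
Qed.

End Length.

(** * Boxes and wires *)

Section Boxes.
Variables n j : nat.
Implicit Types (a b x y z : box n j) (C : {set box n j}) (D : filling n j).
Implicit Types (p q L bs : seq (box n j)).

Definition brow b : nat := b.1.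
Definition bcol b : nat := b.2.

Lemma brow_lt b : brow b < j. Proof. exact: ltn_ord. Qed.
Lemma bcol_lt b : bcol b < n - j. Proof. exact: ltn_ord. Qed.

Lemma box_inj a b : brow a = brow b -> bcol a = bcol b -> a = b.
Proof. by case: a b => [r c] [r' c'] /val_inj /= -> /val_inj /= ->. Qed.

Lemma box_eqE a b : (a == b) = (brow a == brow b) && (bcol a == bcol b).
Proof.
apply/eqP/andP => [-> // | [/eqP eq1 /eqP eq2]].
exact: box_inj.
Qed.

Lemma box_at r c : r < j -> c < n - j ->
  exists z : box n j, brow z = r /\ bcol z = c.
Proof. by move=> lt_r lt_c; exists (Ordinal lt_r, Ordinal lt_c). Qed.

Lemma coverE a b : Defs.cover a b =
  (brow b == brow a) && (bcol b == (bcol a).+1) ||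
  ((brow b).+1 == brow a) && (bcol b == bcol a).
Proof. by []. Qed.

(** A cover goes one column right or one row up. Conversely, a chain from a to b is found by walking
    right first and then up. *)
Lemma qleE a b : qle a b = (brow b <= brow a) && (bcol a <= bcol b).
Proof.
apply/idP/idP => [/connectP[p] | ].
  elim: p a => [a _ -> | c p IHp a] /=; first by rewrite !leqnn.
  case/andP=> ac /IHp{}IHp /IHp; move: ac; rewrite coverE; lia.
have [d] := ubnP (brow a - brow b + (bcol b - bcol a)).
elim: d a => // d IHd a le_d le_ab.
have [lt2 | ge2] := ltnP (bcol a) (bcol b).
  have [||z [z1 z2]] := @box_at (brow a) (bcol a).+1.
  - by have := brow_lt a; lia.
  - by have := bcol_lt b; lia.
  apply: connect_trans (connect1 (_ : Defs.cover a z)) (IHd z _ _); try lia.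
  by rewrite coverE; lia.
have [lt1 | ge1] := ltnP (brow b) (brow a).
  have [||z [z1 z2]] := @box_at (brow a).-1 (bcol a).
  - by have := brow_lt a; lia.
  - by have := bcol_lt a; lia.
  apply: connect_trans (connect1 (_ : Defs.cover a z)) (IHd z _ _); try lia.
  by rewrite coverE; lia.
by rewrite (@box_inj a b); [exact: connect0 | lia | lia].
Qed.

(** The sum of the two weak inequalities is strict exactly when one of them is; this form suits
    [lia]. *)
Lemma qltE a b :
  qlt a b = [&& brow b <= brow a, bcol a <= bcol b & brow b + bcol a < brow a + bcol b].
Proof. by rewrite /qlt qleE box_eqE; lia. Qed.

(** * Convex sets and sweeps *)

Definition convex C :=
  forall a z b, a \in C -> b \in C -> qle a z -> qle z b -> z \in C.

Lemma order_ideal_convex C : order_ideal C -> convex C.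
Proof. by move=> C_ideal a z b _ Cb _ zb; apply: C_ideal zb Cb. Qed.

Lemma itv_cc_convex x y : convex (itv_cc x y).
Proof. by move=> a z b; rewrite !inE !qleE; lia. Qed.

Definition up_closed C p :=
  forall a z, a \in p -> z \in C -> qle a z -> z \in p.

(* L is a linear extension of C read backwards, from large boxes to small. *)
Definition sweep C L :=
  [/\ uniq L, L =i C & forall p q, L = p ++ q -> up_closed C p].

Lemma lin_ext_sweep C bs : lin_ext C bs -> sweep C (rev bs).
Proof.
case=> bs_uniq bsC bs_ord.
split; [by rewrite rev_uniq | by move=> z; rewrite mem_rev |].
move=> p q def_bs a z pa Cz le_az.
have [<- // | ne_az] := eqVneq a z.
apply: contraT => pz.
have def_bs' : bs = rev q ++ rev p by rewrite -rev_cat -def_bs revK.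
have Ca : a \in C by rewrite -bsC def_bs' mem_cat !mem_rev pa orbT.
have := bs_ord a z Ca Cz; rewrite /qlt ne_az le_az => /(_ isT).
move: Cz; rewrite -bsC def_bs' mem_cat !mem_rev (negPf pz) orbF => qz.
have qa : a \in q = false.
  apply/negP => qa; move: bs_uniq; rewrite def_bs' cat_uniq.
  by case/and3P=> _ /hasPn/(_ a); rewrite !mem_rev pa qa => /(_ isT).
rewrite !index_cat !mem_rev qz qa => lt_az.
have lt_z : index z (rev q) < size (rev q) by rewrite index_mem mem_rev.
by have := ltn_trans lt_az lt_z; rewrite ltnNge leq_addr.
Qed.

(* The processed boxes are those of p and b comes next. *)
Definition next_box C p b :=
  [/\ up_closed C p, up_closed C (rcons p b), {subset p <= C}, b \in C &
      b \notin p].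

Lemma sweep_next C L p b q : sweep C L -> L = p ++ b :: q -> next_box C p b.
Proof.
case=> L_uniq LC L_up def_L; split.
- exact: L_up def_L.
- by apply: (L_up _ q); rewrite cat_rcons.
- by move=> z pz; rewrite -LC def_L mem_cat pz.
- by rewrite -LC def_L mem_cat mem_head orbT.
- move: L_uniq; rewrite def_L cat_uniq => /and3P[_ /hasPn/(_ b)].
  by rewrite mem_head => /(_ isT).
Qed.

Lemma next_above C p b z : next_box C p b -> z \in C -> qlt b z -> z \in p.
Proof.
case=> _ p_up _ _ _ Cz /andP[ne_bz le_bz].
have := p_up b z; rewrite !mem_rcons !inE eqxx (eq_sym z) (negPf ne_bz).
by apply.
Qed.

Lemma next_not_below C p b z : next_box C p b -> z \in p -> ~~ qle z b.
Proof.
case=> p_up _ _ Cb pb pz; apply: contra pb => le_zb.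
exact: p_up pz Cb le_zb.
Qed.

Lemma next_below C p b z : next_box C p b -> qlt z b -> z \notin rcons p b.
Proof.
move=> nb /andP[ne_zb le_zb]; rewrite mem_rcons inE negb_or ne_zb.
by apply: contraTN le_zb; apply: next_not_below nb.
Qed.

(* The wire leaving a to the left sits at position brow a + bcol a until the left
   neighbour of a is processed. *)
Lemma next_left C p b a : convex C -> next_box C p b -> a \in p ->
  (forall z, brow z = brow a -> (bcol z).+1 = bcol a -> z \notin p) ->
  [/\ brow b + bcol b != brow a + bcol a,
      (brow b + bcol b).+1 = brow a + bcol a -> brow b = brow a /\ (bcol b).+1 = bcol a &
      brow b = brow a -> bcol b < bcol a -> (bcol b).+1 = bcol a].
Proof.
move=> C_conv nb pa no_left; have := next_not_below nb pa; rewrite qleE => not_ab.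
have [_ _ pC Cb _] := nb.
(* Otherwise the left neighbour of a would lie strictly above b, hence be processed already. *)
have key : brow a <= brow b -> bcol b < bcol a ->
    ~ (brow a < brow b \/ (bcol b).+1 < bcol a).
  move=> le1 lt2 ne.
  have [||z [z1 z2]] := @box_at (brow a) (bcol a).-1.
  - by have := brow_lt a; lia.
  - by have := bcol_lt a; lia.
  have /negP[] := no_left z z1 ltac:(lia).
  apply: (next_above nb); last by rewrite qltE; lia.
  by apply: C_conv Cb (pC _ pa) _ _; rewrite qleE; lia.
split; [apply/eqP | |] => *; lia.
Qed.

(** Mirror image of [next_left]: the wire leaving a downwards sits at position
    [(brow a + bcol a).+1] until the box below a is processed. *)
Lemma next_down C p b a : convex C -> next_box C p b -> a \in p ->
  (forall z, bcol z = bcol a -> brow z = (brow a).+1 -> z \notin p) ->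
  [/\ brow b + bcol b != brow a + bcol a,
      brow b + bcol b = (brow a + bcol a).+1 -> bcol b = bcol a /\ brow b = (brow a).+1 &
      bcol b = bcol a -> brow a < brow b -> brow b = (brow a).+1].
Proof.
move=> C_conv nb pa no_down; have := next_not_below nb pa; rewrite qleE => not_ab.
have [_ _ pC Cb _] := nb.
have key : bcol b <= bcol a -> brow a < brow b ->
    ~ (bcol b < bcol a \/ (brow a).+1 < brow b).
  move=> le2 lt1 ne.
  have [||z [z1 z2]] := @box_at (brow a).+1 (bcol a).
  - by have := brow_lt b; lia.
  - by have := bcol_lt a; lia.
  have /negP[] := no_down z z2 ltac:(lia).
  apply: (next_above nb); last by rewrite qltE; lia.
  by apply: C_conv Cb (pC _ pa) _ _; rewrite qleE; lia.
split; [apply/eqP | |] => *; lia.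
Qed.

(* Factors act on positions: a 0 in b exchanges the wires at positions
   brow b + bcol b (entering from above or leaving to the left) and
   (brow b + bcol b).+1 (entering from the right or leaving downwards). *)
Definition wire_step D (k : nat) b : nat :=
  if D b is Some Zero then
    if k == brow b + bcol b then k.+1 else if k == (brow b + bcol b).+1 then k.-1 else k
  else k.

Definition wire D p (k : nat) : nat := foldl (wire_step D) k p.

Lemma wire_rcons D p b k : wire D (rcons p b) k = wire_step D (wire D p k) b.
Proof. by rewrite /wire foldl_rcons. Qed.

Lemma factor_wire_step D b (o : 'I_n) : factor D b o = wire_step D o b :> nat.
Proof.
rewrite /factor /wire_step; case: (D b) => [[]|]; rewrite ?perm1 //.
rewrite /box_refl; case: tpermP => [->|->|/eqP + /eqP];
  rewrite -?val_eqE /= -?/(brow b) -?/(bcol b).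
- by rewrite eqxx.
- by rewrite eqxx; case: eqP => //; lia.
- by move=> /negPf-> /negPf->.
Qed.

(** Since the first box of p acts first, the partial product sends each entering wire to its
    position after p. *)
Lemma prod_wire D p (o : 'I_n) : (\prod_(b <- p) factor D b) o = wire D p o :> nat.
Proof.
elim/last_ind: p => [|p b IHp]; first by rewrite big_nil perm1.
by rewrite big_rcons /= permM factor_wire_step IHp wire_rcons.
Qed.

Lemma wire_inj D p (o1 o2 : 'I_n) : wire D p o1 = wire D p o2 -> o1 = o2.
Proof. by rewrite -!prod_wire => /val_inj/perm_inj. Qed.

(** * Diagrams without corners *)

(** Here z ranges over all of Q. For an order ideal C this makes no difference: boxes to the left of
    b or below b are smaller than b. *)
Definition corner_free C D := forall b, b \in C -> D b = Some Zero ->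
  (forall z, brow z = brow b -> bcol z < bcol b -> D z = Some Zero) \/
  (forall z, bcol z = bcol b -> brow b < brow z -> D z = Some Zero).

(** The wire at k last left [a] to the left and has only unprocessed zeros ahead, so it never turns
    again. *)
Definition stays_in_row D p (k : nat) := exists a,
  [/\ a \in p, k = brow a + bcol a &
      forall z, brow z = brow a -> bcol z < bcol a -> z \notin p /\ D z = Some Zero].

Definition stays_in_col D p (k : nat) := exists a,
  [/\ a \in p, k = (brow a + bcol a).+1 &
      forall z, bcol z = bcol a -> brow a < brow z -> z \notin p /\ D z = Some Zero].

(** Such a wire can enter a box only from the right, whereas [brow b + bcol b] is where a wire
    enters b from above. If b is the left neighbour of a, its 0 lets the wire through and b takes
    the role of a. *)
Lemma stays_in_row_next C D p b k : convex C -> next_box C p b ->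
  stays_in_row D p k ->
  k <> brow b + bcol b /\ stays_in_row D (rcons p b) (wire_step D k b).
Proof.
move=> C_conv nb [a [pa -> rowa]].
have [|ne next same] := next_left C_conv nb pa.
  by move=> z z1 z2; case: (rowa z z1) => //; lia.
split=> [/esym/eqP|]; first exact/negP.
have [eq_k | ne_k] := eqVneq (brow a + bcol a) (brow b + bcol b).+1.
  have [b1 b2] := next (esym eq_k).
  have [_ Db] := rowa b b1 ltac:(lia).
  exists b; rewrite mem_rcons mem_head /wire_step Db; split=> //.
    by rewrite eq_k eqxx; case: eqP; lia.
  move=> z z1 z2; have [pz Dz] := rowa z ltac:(lia) ltac:(lia).
  by rewrite mem_rcons inE negb_or pz box_eqE Dz; split=> //; lia.
exists a; rewrite mem_rcons inE pa orbT; split=> //.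
  by rewrite /wire_step (negPf ne_k) eq_sym (negPf ne); case: (D b) => [[]|].
move=> z z1 z2; have [pz Dz] := rowa z z1 z2; split=> //.
rewrite mem_rcons inE negb_or pz andbT; apply: contraNneq ne_k => eq_zb.
by rewrite eq_zb in z1 z2; have := same z1 z2; lia.
Qed.

(** Mirror image: a wire running down its column can enter a box only from above. *)
Lemma stays_in_col_next C D p b k : convex C -> next_box C p b ->
  stays_in_col D p k ->
  k <> (brow b + bcol b).+1 /\ stays_in_col D (rcons p b) (wire_step D k b).
Proof.
move=> C_conv nb [a [pa -> cola]].
have [|ne next same] := next_down C_conv nb pa.
  by move=> z z2 z1; case: (cola z z2) => //; lia.
split=> [[] /esym/eqP|]; first exact/negP.
have [eq_k | ne_k] := eqVneq (brow a + bcol a).+1 (brow b + bcol b).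
  have [b2 b1] := next (esym eq_k).
  have [_ Db] := cola b b2 ltac:(lia).
  exists b; rewrite mem_rcons mem_head /wire_step Db; split=> //.
    by rewrite eq_k eqxx.
  move=> z z2 z1; have [pz Dz] := cola z ltac:(lia) ltac:(lia).
  by rewrite mem_rcons inE negb_or pz box_eqE Dz; split=> //; lia.
exists a; rewrite mem_rcons inE pa orbT; split=> //.
  by rewrite /wire_step (negPf ne_k) eqSS eq_sym (negPf ne); case: (D b) => [[]|].
move=> z z2 z1; have [pz Dz] := cola z z2 z1; split=> //.
rewrite mem_rcons inE negb_or pz andbT; apply: contraNneq ne_k => eq_zb.
by rewrite eq_zb in z1 z2; have := same z2 z1; lia.
Qed.

(** Invariant of the sweep. At the 0 where two wires cross, corner-freeness confines the one leaving
    to the left to its row or the one leaving downwards to its column, and the confinement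
    persists. *)
Lemma crossed_wires C D L p q (o1 o2 : 'I_n) :
    convex C -> corner_free C D -> sweep C L -> L = p ++ q -> o1 < o2 ->
    wire D p o2 < wire D p o1 ->
  stays_in_row D p (wire D p o2) \/ stays_in_col D p (wire D p o1).
Proof.
move=> C_conv D_cf sw + lt_o; elim/last_ind: p q => [|p b IHp] q /=.
  by rewrite /wire /=; lia.
rewrite cat_rcons => def_L; have nb := sweep_next sw def_L.
move/(_ _ def_L): IHp; rewrite !wire_rcons.
have := @wire_inj D p o1 o2.
move: (wire D p o1) (wire D p o2) => k1 k2 k_inj IHp lt_k.
have [lt_k' | le_k] := ltnP k2 k1.
  have [row | col] := IHp lt_k'.
    by left; have [] := stays_in_row_next C_conv nb row.
  by right; have [] := stays_in_col_next C_conv nb col.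
have ne_k : k1 <> k2 by move/k_inj=> eq_o; rewrite eq_o ltnn in lt_o.
have [_ _ _ Cb _] := nb.
case Db: (D b) lt_k => [[]|]; rewrite /wire_step Db; try lia.
(* The order of the two wires changes at b, so they are the two wires entering b. *)
move=> lt_k; have [-> ->] : k1 = brow b + bcol b /\ k2 = (brow b + bcol b).+1.
  by move: lt_k; do !case: eqP; lia.
have [in_row | in_col] := D_cf b Cb Db; [left | right]; exists b;
  rewrite mem_rcons mem_head; split=> //.
- by rewrite eqxx; case: eqP => //; lia.
- by move=> z z1 z2; split; [apply: next_below nb _; rewrite qltE; lia | exact: in_row].
- by rewrite eqxx.
- by move=> z z1 z2; split; [apply: next_below nb _; rewrite qltE; lia | exact: in_col].
Qed.

(** A descent at b would mean that the two wires entering b have crossed before. But the one coming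
    from above cannot be confined to a row, nor the one coming from the right to a column. *)
Lemma corner_free_Gamma C D : order_ideal C -> has_shape C D ->
  corner_free C D -> Gamma_diagram C D.
Proof.
move=> C_ideal C_D D_cf; split=> // bs /lin_ext_sweep sw p b q def_bs.
have C_conv := order_ideal_convex C_ideal.
have nb := sweep_next sw def_bs.
set u := \prod_(a <- p) _; rewrite /box_refl.
set i := Ordinal _; set k := Ordinal _.
apply: bruhat_lt_asc => //.
have [//|gt|/val_inj/perm_inj/(congr1 val) /=] := ltngtP; last lia.
have wi : wire D p (u^-1 i) = brow b + bcol b by rewrite -prod_wire -/u permKV.
have wk : wire D p (u^-1 k) = (brow b + bcol b).+1 by rewrite -prod_wire -/u permKV.
have [|row|col] := crossed_wires C_conv D_cf sw def_bs gt.
- by rewrite wi wk.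
- by have [] := stays_in_row_next C_conv nb row; rewrite wi.
- by have [] := stays_in_col_next C_conv nb col; rewrite wk.
Qed.

End Boxes.

(** * Rectangular moves *)

Section Rectangles.
Variables n j : nat.
Implicit Types (a b x y z : box n j) (C O : {set box n j}) (D : filling n j).
Implicit Types (p q L bs : seq (box n j)).

Definition rect_symbol x y z : symbol :=
  if (brow z == brow y) && (bcol z == bcol x) ||
     (brow z == brow x) && (bcol z == bcol y) then Plus else Zero.

Lemma rect_patternE x y z : rect_pattern x y z =
  if qlt x z && qlt z y then Some (Fixed (rect_symbol x y z)) else None.
Proof.
by rewrite /rect_pattern inE !(@box_eqE n j) /rect_symbol /brow /bcol /=.
Qed.

Definition rect_filled x y D :=
  forall z, qlt x z -> qlt z y -> D z = Some (rect_symbol x y z).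

Lemma compatible_rectP x y D :
  compatible D (rect_pattern x y) <-> rect_filled x y D.
Proof.
split=> [cD z xz zy | fD z s].
  by apply: cD; rewrite rect_patternE xz zy.
by rewrite rect_patternE; case: andP => // -[xz zy] [<-]; apply: fD.
Qed.

(** * Tracing the two wires from y to x *)

Section Trace.
Variables (C : {set box n j}) (D : filling n j) (L p1 p2 p3 : seq (box n j)).
Variables (x y : box n j).
Hypotheses (C_conv : convex C) (sw : sweep C L).
Hypothesis def_L : L = p1 ++ y :: p2 ++ x :: p3.
Hypotheses (lt_row : brow y < brow x) (lt_col : bcol x < bcol y).
Hypothesis D_rect : rect_filled x y D.

Let next_p q b r : p2 = rcons q b ++ r -> next_box C (rcons p1 y ++ q) b.
Proof.
move=> def_p; apply: (sweep_next (q := r ++ x :: p3)) sw _.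
by rewrite def_L def_p cat_rcons -!catA /= -!cats1 -!catA.
Qed.

Let next_x : next_box C (rcons p1 y ++ p2) x.
Proof.
by apply: (sweep_next (q := p3)) sw _; rewrite def_L cat_rcons -!catA.
Qed.

Let next_y : next_box C p1 y.
Proof. exact: sweep_next sw def_L. Qed.

Let ne_x q b r : p2 = rcons q b ++ r -> b != x.
Proof.
move=> def_p; have [_ _ _ _ ] := next_x; apply: contraNneq => <-.
by rewrite def_p !mem_cat !mem_rcons !inE eqxx !orbT.
Qed.

(** The wire follows the row of y to the corner in the column of x, turns down there and follows
    that column. In both alternatives [a] is the last box passed, and the last clause says that the
    next box on the way is unprocessed. *)
Lemma left_wire q r : p2 = q ++ r ->
  let k := wire D q (brow y + bcol y) in let P := rcons p1 y ++ q in
  exists2 a, a \in P &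
    [/\ brow a = brow y, bcol x < bcol a <= bcol y, k = brow a + bcol a &
        forall z, brow z = brow a -> (bcol z).+1 = bcol a -> z \notin P] \/
    [/\ bcol a = bcol x, brow y <= brow a < brow x, k = (brow a + bcol a).+1 &
        forall z, bcol z = bcol a -> brow z = (brow a).+1 -> z \notin P].
Proof.
elim/last_ind: q r => [|q b IHq] r def_p /=.
  exists y; first by rewrite cats0 mem_rcons mem_head.
  left; split=> //; first by rewrite lt_col leqnn.
  by move=> z z1 z2; rewrite cats0 (next_below next_y) // qltE; lia.
have nb := next_p def_p; have ne_bx := ne_x def_p.
rewrite box_eqE in ne_bx.
have [|a Pa] := IHq (b :: r); first by rewrite def_p cat_rcons.
rewrite -rcons_cat wire_rcons.
case=> [[a1 a2 -> a_next] | [a2 a1 -> a_next]].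
  have [ne nxt _] := next_left C_conv nb Pa a_next.
  have [eq_b | ne_b] := eqVneq (brow b + bcol b).+1 (brow a + bcol a).
    have [b1 b2] := nxt eq_b.
    exists b; first by rewrite mem_rcons mem_head.
    have Db := D_rect (z := b); rewrite !qltE in Db.
    have {}Db := Db ltac:(lia) ltac:(lia).
    rewrite /wire_step Db /rect_symbol -eq_b.
    (* If b is the corner, its + turns the wire downwards; otherwise its 0 lets the wire go on to
       the left. *)
    have [eq_x | ne_xb] := eqVneq (bcol b) (bcol x).
      right; rewrite b1 a1 eqxx /=; split=> //; try lia.
      move=> z z2 z1; apply: next_below nb _; rewrite qltE; lia.
    left; rewrite andbF /=; split; try lia.
      by rewrite b1 a1; case: andP => [[/eqP]|_]; do ?case: eqP; lia.
    move=> z z1 z2; apply: next_below nb _; rewrite qltE; lia.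
  exists a; first by rewrite mem_rcons inE Pa orbT.
  left; split=> //.
    by rewrite /wire_step; case: (D b) => [[]|] //; do ?case: eqP; lia.
  move=> z z1 z2; rewrite mem_rcons inE negb_or a_next // andbT box_eqE.
  lia.
have [ne nxt _] := next_down C_conv nb Pa a_next.
have [eq_b | ne_b] := eqVneq (brow b + bcol b) (brow a + bcol a).+1.
  have [b2 b1] := nxt eq_b.
  exists b; first by rewrite mem_rcons mem_head.
  have Db := D_rect (z := b); rewrite !qltE in Db.
  have {}Db := Db ltac:(lia) ltac:(lia).
  rewrite /wire_step Db /rect_symbol -eq_b.
  right; split; try lia.
    by rewrite eqxx; do ?case: eqP => //=; lia.
  move=> z z1 z2; apply: next_below nb _; rewrite qltE; lia.
exists a; first by rewrite mem_rcons inE Pa orbT.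
right; split=> //.
  by rewrite /wire_step; case: (D b) => [[]|] //; do ?case: eqP; lia.
move=> z z1 z2; rewrite mem_rcons inE negb_or a_next // andbT box_eqE.
lia.
Qed.

(** Mirror image of [left_wire]: down the column of y, then left along the row of x. *)
Lemma down_wire q r : p2 = q ++ r ->
  let k := wire D q (brow y + bcol y).+1 in let P := rcons p1 y ++ q in
  exists2 a, a \in P &
    [/\ bcol a = bcol y, brow y <= brow a < brow x, k = (brow a + bcol a).+1 &
        forall z, bcol z = bcol a -> brow z = (brow a).+1 -> z \notin P] \/
    [/\ brow a = brow x, bcol x < bcol a <= bcol y, k = brow a + bcol a &
        forall z, brow z = brow a -> (bcol z).+1 = bcol a -> z \notin P].
Proof.
elim/last_ind: q r => [|q b IHq] r def_p /=.
  exists y; first by rewrite cats0 mem_rcons mem_head.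
  left; split=> //; first by rewrite lt_row leqnn.
  by move=> z z1 z2; rewrite cats0 (next_below next_y) // qltE; lia.
have nb := next_p def_p; have ne_bx := ne_x def_p.
rewrite box_eqE in ne_bx.
have [|a Pa] := IHq (b :: r); first by rewrite def_p cat_rcons.
rewrite -rcons_cat wire_rcons.
case=> [[a2 a1 -> a_next] | [a1 a2 -> a_next]].
  have [ne nxt _] := next_down C_conv nb Pa a_next.
  have [eq_b | ne_b] := eqVneq (brow b + bcol b) (brow a + bcol a).+1.
    have [b2 b1] := nxt eq_b.
    exists b; first by rewrite mem_rcons mem_head.
    have Db := D_rect (z := b); rewrite !qltE in Db.
    have {}Db := Db ltac:(lia) ltac:(lia).
    rewrite /wire_step Db /rect_symbol -eq_b.
    have [eq_x | ne_xb] := eqVneq (brow b) (brow x).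
      right; rewrite b2 a2 eqxx orbT; split=> //; try lia.
      move=> z z2 z1; apply: next_below nb _; rewrite qltE; lia.
    left; split; try lia.
      by rewrite eqxx; do ?case: eqP => //=; lia.
    move=> z z1 z2; apply: next_below nb _; rewrite qltE; lia.
  exists a; first by rewrite mem_rcons inE Pa orbT.
  left; split=> //.
    by rewrite /wire_step; case: (D b) => [[]|] //; do ?case: eqP; lia.
  move=> z z1 z2; rewrite mem_rcons inE negb_or a_next // andbT box_eqE.
  lia.
have [ne nxt _] := next_left C_conv nb Pa a_next.
have [eq_b | ne_b] := eqVneq (brow b + bcol b).+1 (brow a + bcol a).
  have [b1 b2] := nxt eq_b.
  exists b; first by rewrite mem_rcons mem_head.
  have Db := D_rect (z := b); rewrite !qltE in Db.
  have {}Db := Db ltac:(lia) ltac:(lia).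
  rewrite /wire_step Db /rect_symbol -eq_b.
  right; split; try lia.
    by do ?case: eqP => //=; lia.
  move=> z z1 z2; apply: next_below nb _; rewrite qltE; lia.
exists a; first by rewrite mem_rcons inE Pa orbT.
right; split=> //.
  by rewrite /wire_step; case: (D b) => [[]|] //; do ?case: eqP; lia.
move=> z z1 z2; rewrite mem_rcons inE negb_or a_next // andbT box_eqE.
lia.
Qed.

Let between_mem a z :
  a \in rcons p1 y ++ p2 -> qlt x z -> qle z a -> z \in rcons p1 y ++ p2.
Proof.
move=> Pa lt_xz le_za; apply: (next_above next_x _ lt_xz).
have [_ _ PC Cx _] := next_x.
exact: C_conv Cx (PC _ Pa) (andP lt_xz).2 le_za.
Qed.

(* The two wires leaving y meet again in x. *)
Lemma rect_conj :
  let u := \prod_(b <- p2) factor D b in box_refl y * u = u * box_refl x.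
Proof.
(* Conjugation by u carries a transposition to that of the images, so it remains to see where the
   two wires end. *)
move=> u; rewrite conjgC; congr (_ * _); rewrite /box_refl tpermJ.
set i := Ordinal _; set i' := Ordinal _; set k := Ordinal _; set k' := Ordinal _.
have -> : u i = k.
  apply: val_inj; rewrite /= prod_wire.
  have [a Pa ends] := left_wire (esym (cats0 p2)).
  (* When x comes next, every box of C above x is processed. So the wire cannot have its next box
     strictly above x, and it is about to enter x. *)
  case: ends => [[a1 a2 _ a_next] | [a2 a1 k_eq a_next]].
    have [||z [z1 z2]] := @box_at n j (brow a) (bcol a).-1.
    - exact: brow_lt.
    - by have := bcol_lt a; lia.
    have /negP[] := a_next z z1 ltac:(lia).
    by apply: between_mem Pa _ _; rewrite ?qltE ?qleE; lia.
  rewrite -[RHS]/(brow x + bcol x) -[LHS]/(wire D p2 (brow y + bcol y)) k_eq.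
  have [eq_ax | ne_ax] := eqVneq (brow a).+1 (brow x); first lia.
  have [||z [z1 z2]] := @box_at n j (brow a).+1 (bcol a).
  - by have := brow_lt x; lia.
  - exact: bcol_lt.
  have /negP[] := a_next z z2 z1.
  by apply: between_mem Pa _ _; rewrite ?qltE ?qleE; lia.
have -> // : u i' = k'.
apply: val_inj; rewrite /= prod_wire.
have [a Pa ends] := down_wire (esym (cats0 p2)).
case: ends => [[a2 a1 _ a_next] | [a1 a2 k_eq a_next]].
  have [||z [z1 z2]] := @box_at n j (brow a).+1 (bcol a).
  - by have := brow_lt x; lia.
  - exact: bcol_lt.
  have /negP[] := a_next z z2 z1.
  by apply: between_mem Pa _ _; rewrite ?qltE ?qleE; lia.
rewrite -[RHS]/(brow x + bcol x).+1 -[LHS]/(wire D p2 (brow y + bcol y).+1) k_eq.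
have [eq_ax | ne_ax] := eqVneq (bcol a) (bcol x).+1; first lia.
have [||z [z1 z2]] := @box_at n j (brow a) (bcol a).-1.
- exact: brow_lt.
- by have := bcol_lt a; lia.
have /negP[] := a_next z z1 ltac:(lia).
by apply: between_mem Pa _ _; rewrite ?qltE ?qleE; lia.
Qed.

End Trace.

End Rectangles.

Section Moves.
Variables n j : nat.
Implicit Types (a b x y z : box n j) (C O : {set box n j}) (D : filling n j).
Implicit Types (p q L bs : seq (box n j)).

(** * Independence of the linear extension *)

Lemma box_refl2 b : box_refl b * box_refl b = 1.
Proof. exact: tperm2. Qed.

(** Distinct incomparable boxes differ in row and in column in the same sense, so their labels
    differ by at least 2 and the transpositions are disjoint. *)
Lemma commute_incomparable D a b :
  ~~ qlt a b -> ~~ qlt b a -> commute (factor D a) (factor D b).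
Proof.
have [-> // | ] := eqVneq a b.
rewrite box_eqE !qltE /factor => ne_ab nab nba.
case: (D a) => [[]|]; case: (D b) => [[]|];
  try by apply/commute_sym/commute1.
- rewrite /commute conjgC; congr (_ * _); rewrite /box_refl.
  have [i [i' [-> -> vi vi']]] : exists i i', [/\
      Ordinal (ltnW (box_label_lt a)) = i, Ordinal (box_label_lt a) = i',
      i = brow a + bcol a :> nat & i' = (brow a + bcol a).+1 :> nat].
    by do 2!eexists.
  have [k [k' [-> -> vk vk']]] : exists k k', [/\
      Ordinal (ltnW (box_label_lt b)) = k, Ordinal (box_label_lt b) = k',
      k = brow b + bcol b :> nat & k' = (brow b + bcol b).+1 :> nat].
    by do 2!eexists.
  by rewrite tpermJ !tpermD // -val_eqE /= ?vi ?vi' ?vk ?vk'; lia.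
- exact: commute1.
- exact: commute1.
Qed.

(** A condition on pairs is inherited by subsequences, as the induction in [prod_pairwise]
    requires. *)
Lemma sweep_pairwise C L : sweep C L -> pairwise (fun a b => ~~ qlt a b) L.
Proof.
case=> L_uniq LC L_up; case: L => // a0 L' in L_uniq LC L_up *.
set L := a0 :: L' in L_uniq LC L_up *.
apply/(pairwiseP a0) => i k lt_i lt_k lt_ik; rewrite !inE in lt_i lt_k.
apply/negP => /andP[_ le_ik].
have L_split : L = take i.+1 L ++ drop i.+1 L by rewrite cat_take_drop.
have : nth a0 L k \in take i.+1 L.
  apply: L_up L_split _ _ _ _ le_ik; last by rewrite -LC mem_nth.
  by rewrite (take_nth a0) // mem_rcons mem_head.
have lt_k' : index (nth a0 L k) L = k by apply: index_uniq.
by rewrite in_take ?mem_nth // lt_k' ltnS leqNgt lt_ik.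
Qed.

(** Let [M1] be what precedes the head a of L in [L']. For c in [M1], L excludes a < c and [L']
    excludes c < a, so the factor of a commutes to the front. *)
Lemma prod_pairwise D L L' : perm_eq L L' ->
  pairwise (fun a b => ~~ qlt a b) L -> pairwise (fun a b => ~~ qlt a b) L' ->
  \prod_(a <- L) factor D a = \prod_(a <- L') factor D a.
Proof.
elim: L L' => [|a L IHL] L' eqLL'.
  by move/perm_size/esym/size0nil: eqLL' => ->.
have L'a : a \in L' by rewrite -(perm_mem eqLL') mem_head.
case/splitPr: L' / L'a eqLL' => M1 M2 eqLM /= /andP[/allP a_L L_pw].
rewrite pairwise_cat /= => /and3P[/allrelP M_rel M1_pw /andP[_ M2_pw]].
have eqLM' : perm_eq L (M1 ++ M2).
  rewrite -(perm_cons a) (permPl eqLM).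
  exact: permEl (perm_catCA M1 [:: a] M2).
rewrite big_cons (IHL (M1 ++ M2)) //; last first.
  rewrite pairwise_cat M1_pw M2_pw !andbT; apply/allrelP => c d M1c M2d.
  by apply: M_rel; rewrite // inE M2d orbT.
rewrite !big_cat big_cons /= !mulgA; congr (_ * _).
rewrite -/(commute _ _) [X in commute _ X]big_seq; apply: commute_prod => c M1c.
apply: commute_incomparable.
  by apply: a_L; rewrite (perm_mem eqLM') mem_cat M1c.
by apply: M_rel; rewrite // mem_head.
Qed.

Lemma vprod_lin_ext C D bs cs :
  lin_ext C bs -> lin_ext C cs -> vprod D bs = vprod D cs.
Proof.
move=> /lin_ext_sweep sw /lin_ext_sweep sw'; rewrite /vprod.
apply: prod_pairwise; [|exact: sweep_pairwise sw|exact: sweep_pairwise sw'].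
have [[bs_uniq bsC _] [cs_uniq csC _]] := (sw, sw').
by apply: uniq_perm => // z; rewrite bsC csC.
Qed.

(** * Rectangular moves are Gamma-moves *)

Lemma lin_ext_cons C x bs : x \notin C -> {in C, forall z, ~~ qlt z x} ->
  lin_ext C bs -> lin_ext (x |: C) (x :: bs).
Proof.
move=> Cx x_min [bs_uniq bsC bs_ord]; split=> [|z|a b].
- by rewrite /= bsC Cx.
- by rewrite !inE bsC.
rewrite !inE /= => Ca Cb lt_ab.
have [eq_xb | ne_xb] := eqVneq x b.
  move: lt_ab Ca; rewrite -eq_xb => lt_ax /orP[/eqP eq_a | Ca].
    by rewrite eq_a /qlt eqxx in lt_ax.
  by rewrite (negPf (x_min a Ca)) in lt_ax.
have [//| ne_xa] := eqVneq x a.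
rewrite ltnS; apply: bs_ord => //.
  by move: Ca; rewrite eq_sym (negPf ne_xa).
by move: Cb; rewrite eq_sym (negPf ne_xb).
Qed.

Lemma lin_ext_rcons C y bs : y \notin C -> {in C, forall z, ~~ qlt y z} ->
  lin_ext C bs -> lin_ext (y |: C) (rcons bs y).
Proof.
move=> Cy y_max [bs_uniq bsC bs_ord]; split=> [|z|a b].
- by rewrite rcons_uniq bsC Cy.
- by rewrite mem_rcons !inE bsC.
rewrite !inE -cats1 !index_cat !bsC => Ca Cb lt_ab.
have [Ca' | Ca'] := boolP (a \in C); last first.
  have eq_a : a = y by move: Ca; rewrite (negPf Ca') orbF => /eqP.
  case/orP: Cb => [/eqP eq_b | Cb]; first by rewrite eq_a eq_b /qlt eqxx in lt_ab.
  by rewrite eq_a (negPf (y_max b Cb)) in lt_ab.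
case: ifP => Cb'; first exact: bs_ord.
by rewrite ltn_addr // index_mem bsC.
Qed.

Lemma itv_coE x y : qlt x y -> itv_co x y = x |: itv_oo x y.
Proof.
move=> xy; apply/setP => z; rewrite !inE.
by move: xy; rewrite /qlt !qleE !box_eqE; lia.
Qed.

Lemma itv_ocE x y : qlt x y -> itv_oc x y = y |: itv_oo x y.
Proof.
move=> xy; apply/setP => z; rewrite !inE.
by move: xy; rewrite /qlt !qleE !box_eqE; lia.
Qed.

Lemma itv_ccE x y : qlt x y -> itv_cc x y = y |: itv_co x y.
Proof.
move=> xy; apply/setP => z; rewrite !inE.
by move: xy; rewrite /qlt !qleE !box_eqE; lia.
Qed.

(** Both products are evaluated along one linear extension of the open interval, with x put in front
    or y at the end; [rect_conj] on the closed interval then compares them. *)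
Lemma rect_Gamma_move x y : brow y < brow x -> bcol x < bcol y ->
  Gamma_move (Move x y (rect_pattern x y)).
Proof.
move=> lt_row lt_col; have lt_xy : qlt x y by rewrite qltE; lia.
split=> //.
  by move=> z; rewrite rect_patternE !inE; case: ifP.
move=> D D_shape /compatible_rectP D_rect cx cy ex_x ex_y.
have [bs ex_bs] := lin_ext_ex (itv_oo x y).
have [bs_uniq bs_mem _] := ex_bs.
have bs_x : x \notin bs by rewrite bs_mem !inE /qlt eqxx.
have bs_y : y \notin bs by rewrite bs_mem !inE /qlt eqxx andbF.
have ex_xbs : lin_ext (itv_co x y) (x :: bs).
  rewrite itv_coE //; apply: lin_ext_cons => //; first by rewrite -bs_mem.
  by move=> z; rewrite inE !qltE; lia.
have ex_bsy : lin_ext (itv_oc x y) (rcons bs y).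
  rewrite itv_ocE //; apply: lin_ext_rcons => //; first by rewrite -bs_mem.
  by move=> z; rewrite inE !qltE; lia.
have ex_xbsy : lin_ext (itv_cc x y) (rcons (x :: bs) y).
  rewrite itv_ccE //; apply: lin_ext_rcons => //.
    by rewrite inE /qlt eqxx andbF.
  by move=> z; rewrite inE qleE !qltE; lia.
rewrite (vprod_lin_ext _ ex_x ex_xbs) (vprod_lin_ext _ ex_y ex_bsy).
have def_L : rev (rcons (x :: bs) y) = [::] ++ y :: rev bs ++ [:: x].
  by rewrite rev_rcons rev_cons cats1.
have prodE b : b \notin bs ->
    \prod_(a <- rev bs) factor (add_zero D b) a = \prod_(a <- rev bs) factor D a.
  move=> bs_b; apply: eq_big_seq => z; rewrite mem_rev /factor ffunE.
  by case: eqP => // ->; rewrite (negPf bs_b).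
have factorE b : factor (add_zero D b) b = box_refl b by rewrite /factor ffunE eqxx.
rewrite /vprod rev_rcons rev_cons big_rcons big_cons /= !factorE !prodE //.
exact/esym/(rect_conj (@itv_cc_convex n j x y) (lin_ext_sweep ex_xbsy) def_L).
Qed.

(** * Finding a rectangle in a diagram with a corner *)

Definition is_zero (s : option symbol) := if s is Some Zero then true else false.

Lemma is_zeroP s : reflect (s = Some Zero) (is_zero s).
Proof. by case: s => [[]|]; constructor. Qed.

Lemma not_zero_plus O D z : has_shape O D -> z \in O -> ~~ is_zero (D z) ->
  D z = Some Plus.
Proof. by move=> /(_ z) <-; case: (D z) => [[]|]. Qed.

(* Any further + in the rectangle spanned by y, a and b yields a smaller one. *)
Lemma corner_rect O D y a b : order_ideal O -> has_shape O D -> y \in O ->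
    D y = Some Zero -> D a = Some Plus -> D b = Some Plus ->
    brow a = brow y -> bcol a < bcol y -> bcol b = bcol y -> brow y < brow b ->
  exists x y', [/\ y' \in O, brow y' < brow x, bcol x < bcol y',
                   D y' = Some Zero & rect_filled x y' D].
Proof.
move=> O_ideal O_D.
have [d] := ubnP (bcol y - bcol a + (brow b - brow y)).
elim: d y a b => // d IHd y a b le_d Oy Dy Da Db a1 a2 b2 b1.
have [||x [x1 x2]] := @box_at n j (brow b) (bcol a).
- exact: brow_lt.
- exact: bcol_lt.
(* Either the rectangle is filled as required, or some z violates the pattern. As a and b do carry
   +, such a z carries + where 0 is expected. *)
have [/existsP[z /and3P[xz zy wrong]] | filled] := boolP [exists z, [&& qlt x z,
    qlt z y & is_zero (D z) != is_zero (Some (rect_symbol x y z))]]; last first.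
  exists x, y; split=> //; try lia.
  move=> z xz zy; have Oz : z \in O by apply: O_ideal (andP zy).2 Oy.
  move: filled; rewrite negb_exists => /forallP/(_ z).
  rewrite xz zy /= negbK.
  have := O_D z; rewrite Oz.
  by case: (D z) => [[]|] //; case: rect_symbol.
have Oz : z \in O by apply: O_ideal (andP zy).2 Oy.
rewrite !qltE in xz zy.
have ne_a : z <> a by move=> eq_z; move: wrong;
  rewrite /rect_symbol eq_z Da a1 x2 !eqxx.
have ne_b : z <> b by move=> eq_z; move: wrong;
  rewrite /rect_symbol eq_z Db b2 x1 !eqxx orbT.
have pos : ~ (brow z = brow a /\ bcol z = bcol a) /\
           ~ (brow z = brow b /\ bcol z = bcol b).
  by split=> -[z1 z2]; [apply: ne_a | apply: ne_b]; apply: box_inj.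
have Dz : D z = Some Plus.
  apply: not_zero_plus O_D Oz _; move: wrong.
  by rewrite /rect_symbol; case: ifP; [lia | case: is_zero].
have [z1 | z1] := eqVneq (brow z) (brow y).
  by apply: (IHd y z b) => //; lia.
have [z2 | z2] := eqVneq (bcol z) (bcol y).
  by apply: (IHd y a z) => //; lia.
(* In the column of a, projecting z to the row of y would only give a back, so z is projected to the
   column of y. If the projection [y'] carries 0 it replaces y, with z in place of a; if it carries
   + it replaces b. *)
have [z2' | z2'] := eqVneq (bcol z) (bcol a).
  have [||y' [y1 y2]] := @box_at n j (brow z) (bcol y).
  - exact: brow_lt.
  - exact: bcol_lt.
  have Oy' : y' \in O by apply: O_ideal Oy; rewrite qleE; lia.
  have [/is_zeroP Dy' | /(not_zero_plus O_D Oy') Dy'] := boolP (is_zero (D y')).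
    by apply: (IHd y' z b) => //; lia.
  by apply: (IHd y a y') => //; lia.
(* Now the projection to the row of y lies strictly between a and y. It replaces y, with z in place
   of b, or it replaces a. *)
have [||y' [y1 y2]] := @box_at n j (brow y) (bcol z).
- exact: brow_lt.
- exact: bcol_lt.
have Oy' : y' \in O by apply: O_ideal Oy; rewrite qleE; lia.
have [/is_zeroP Dy' | /(not_zero_plus O_D Oy') Dy'] := boolP (is_zero (D y')).
  by apply: (IHd y' a z) => //; lia.
by apply: (IHd y y' b) => //; lia.
Qed.

Lemma corner_free_or_rect O D : order_ideal O -> has_shape O D ->
  corner_free O D \/
  exists x y, [/\ y \in O, brow y < brow x, bcol x < bcol y,
                  D y = Some Zero & rect_filled x y D].
Proof.
move=> O_ideal O_D.
pose left_plus y a := [&& brow a == brow y, bcol a < bcol y & ~~ is_zero (D a)].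
pose down_plus y b := [&& bcol b == bcol y, brow y < brow b & ~~ is_zero (D b)].
have [/existsP[y /and4P[Oy /is_zeroP Dy]] | no_corner] :=
    boolP [exists y, [&& y \in O, is_zero (D y), [exists a, left_plus y a] &
                         [exists b, down_plus y b]]].
  move=> /existsP[a /and3P[/eqP a1 a2 Da]] /existsP[b /and3P[/eqP b2 b1 Db]].
  right; apply: (corner_rect (y := y) (a := a) (b := b)) => //.
    by apply: not_zero_plus O_D _ Da; apply: O_ideal Oy; rewrite qleE; lia.
  by apply: not_zero_plus O_D _ Db; apply: O_ideal Oy; rewrite qleE; lia.
left=> y Oy Dy; move: no_corner; rewrite negb_exists => /forallP/(_ y).
rewrite Oy Dy /= negb_and => /orP[] /existsPn no_plus; [left | right].
  move=> z z1 z2; have := no_plus z; rewrite /left_plus z1 eqxx z2 /= negbK.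
  by move/is_zeroP.
move=> z z2 z1; have := no_plus z; rewrite /down_plus z2 eqxx z1 /= negbK.
by move/is_zeroP.
Qed.

Lemma rect_rectangular O x y : order_ideal O -> y \in O ->
  brow y < brow x -> bcol x < bcol y ->
  rectangular (Move x y (rect_pattern x y)).
Proof.
move=> O_ideal Oy lt_row lt_col.
have lt_xy : qlt x y by rewrite qltE; lia.
have ix : x \in itv_cc x y by rewrite !inE !qleE; lia.
have iy : y \in itv_cc x y by rewrite !inE !qleE; lia.
exists O, x, y; split; first by split=> //; apply: O_ideal (andP lt_xy).2 Oy.
split=> //.
  have ne1 : x.1 != y.1 by rewrite -val_eqE -[_ == _]/(brow x == brow y); lia.
  apply: (@leq_trans #|[set x.1; y.1]|); first by rewrite cards2 ne1.
  by apply/subset_leq_card/subsetP => r; rewrite !inE => /orP[] /eqP ->;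
    apply: imset_f.
have ne2 : x.2 != y.2 by rewrite -val_eqE -[_ == _]/(bcol x == bcol y); lia.
apply: (@leq_trans #|[set x.2; y.2]|); first by rewrite cards2 ne2.
by apply/subset_leq_card/subsetP => r; rewrite !inE => /orP[] /eqP ->;
  apply: imset_f.
Qed.

(** If x and y shared a row or a column, the whole interval would lie in it. *)
Lemma rectangular_lt (m : move n j) : rectangular m -> exists x y,
  [/\ brow y < brow x, bcol x < bcol y & m = Move x y (rect_pattern x y)].
Proof.
case=> O [x [y [[_ _ _ lt_xy] [card1 card2 ->]]]]; exists x, y; split=> //.
  rewrite ltnNge; apply: contraTN card1 => le_xy; rewrite -leqNgt -(cards1 x.1).
  apply/subset_leq_card/subsetP => r /imsetP[z + ->]; rewrite !inE -val_eqE.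
  rewrite -[X in _ -> is_true X]/(brow z == brow x) !qleE; lia.
rewrite ltnNge; apply: contraTN card2 => le_xy; rewrite -leqNgt -(cards1 x.2).
apply/subset_leq_card/subsetP => r /imsetP[z + ->]; rewrite !inE -val_eqE.
rewrite -[X in _ -> is_true X]/(bcol z == bcol x) !qleE; lia.
Qed.

(** * Effect of a move, termination and uniqueness *)

Lemma perform_shape O D (m : move n j) : has_shape O D -> mv_y m \in O ->
  has_shape O (perform m D).
Proof.
case: m => x y pat O_D /= Oy b; rewrite ffunE.
case: eqP => [-> // | _]; case: eqP => [-> | _]; last exact: O_D.
by rewrite -O_D; case: (D x).
Qed.

Lemma perform_vprod O D x y pat bs : convex O -> lin_ext O bs ->
    x \in O -> y \in O -> brow y < brow x -> bcol x < bcol y ->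
    has_shape O D -> D y = Some Zero -> rect_filled x y D ->
  vprod (perform (Move x y pat) D) bs = vprod D bs.
Proof.
move=> O_conv ex_bs Ox Oy lt_row lt_col O_D Dy D_rect.
have lt_xy : qlt x y by rewrite qltE; lia.
have sw := lin_ext_sweep ex_bs; have [L_uniq LO L_up] := sw.
rewrite /vprod; move: (rev bs) sw L_uniq LO L_up => L sw L_uniq LO L_up.
have Ly : y \in L by rewrite LO.
case/splitPr: Ly sw L_uniq LO L_up => p1 r sw L_uniq LO L_up.
have : x \in p1 ++ y :: r by rewrite LO.
have ny := sweep_next sw erefl.
rewrite mem_cat inE (negPf (andP lt_xy).1) /=.
have -> /= : (x \in p1) = false.
  apply/negP => p1x; have := next_not_below ny p1x.
  by rewrite (andP lt_xy).2.
move=> rx; case/splitPr: rx sw L_uniq LO L_up ny => p2 p3 sw L_uniq _ _ _.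
have := rect_conj O_conv sw erefl lt_row lt_col D_rect.
have fE q : x \notin q -> y \notin q ->
    \prod_(b <- q) factor (perform (Move x y pat) D) b = \prod_(b <- q) factor D b.
  move=> qx qy; apply: eq_big_seq => z qz; rewrite /factor ffunE.
  case: eqP => [eq_z | _]; first by rewrite -eq_z qz in qy.
  by case: eqP => [eq_z | //]; first by rewrite -eq_z qz in qx.
have [y1 y2 y3] : [/\ y \notin p1, y \notin p2 & y \notin p3].
  move: L_uniq; rewrite -[y :: _]/([:: y] ++ _) uniq_catCA /= => /andP[+ _].
  by rewrite !mem_cat inE !negb_or => /and4P[].
have [x1 x2 x3] : [/\ x \notin p1, x \notin p2 & x \notin p3].
  move: L_uniq; rewrite -cat_cons catA -[x :: _]/([:: x] ++ _) uniq_catCA /=.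
  by case/andP; rewrite !mem_cat inE !negb_or => /andP[/and3P[]].
rewrite !big_cat !big_cons !big_cat !big_cons /= !fE //.
have -> : factor (perform (Move x y pat) D) y = 1 by rewrite /factor ffunE eqxx.
have -> : factor D y = box_refl y by rewrite /factor Dy.
(* Toggling the symbol in x multiplies its factor by [box_refl x], whichever symbol it was. This
   absorbs the reflection that [rect_conj] carries from y to x. *)
have -> : factor D x = box_refl x * factor (perform (Move x y pat) D) x.
  rewrite /factor ffunE (negPf (andP lt_xy).1) eqxx; have := O_D x; rewrite Ox.
  by case: (D x) => [[]|] //= _; rewrite ?mulg1 ?box_refl2.
move=> conj_u; congr (_ * _); rewrite mul1g !mulgA conj_u.
by rewrite -(mulgA _ (box_refl x) (box_refl x)) box_refl2 mulg1.
Qed.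

(** The weight of a single 0 is positive, as [brow b < j], and strictly increases along the order.
    So losing the 0 in y outweighs gaining one in x. *)
Definition weight D : nat :=
  \sum_(b : box n j) is_zero (D b) * (j - brow b + bcol b).

Lemma perform_weight D x y pat : qlt x y -> D y = Some Zero ->
  weight (perform (Move x y pat) D) < weight D.
Proof.
move=> lt_xy Dy; have ne_xy := (andP lt_xy).1.
rewrite /weight (bigD1 y) // (bigD1 x) //= [in X in _ < X](bigD1 y) //=.
rewrite [in X in _ < X](bigD1 x) //= !ffunE !eqxx (negPf ne_xy) Dy /=.
set s := (X in _ + (_ + X) < _); set t := (X in _ < _ + (_ + X)).
have -> : s = t.
  apply: eq_bigr => z /andP[zy zx].
  by rewrite ffunE (negPf zy) (negPf zx).
rewrite qltE in lt_xy; have := brow_lt x; have := brow_lt y.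
by case: (D x) => [[]|] /=; lia.
Qed.

Lemma reach_Gamma O D : order_ideal O -> has_shape O D ->
  exists Dp, is_plus_of O D Dp /\
    clos_refl_trans (filling n j) (move_step (@rectangular n j) O) D Dp.
Proof.
move=> O_ideal; have [d] := ubnP (weight D).
elim: d D => // d IHd D lt_d O_D.
have [cf | [x [y [Oy lt_row lt_col Dy D_rect]]]] := corner_free_or_rect O_ideal O_D.
  (* Without corners D is a Gamma-diagram, hence its own D_+. *)
  exists D; split; last exact: rt_refl.
  by split=> //; apply: corner_free_Gamma.
have lt_xy : qlt x y by rewrite qltE; lia.
have Ox : x \in O by apply: O_ideal (andP lt_xy).2 Oy.
pose m := Move x y (rect_pattern x y).
have [||Dp [[Dp_Gamma Dp_v] D'Dp]] := IHd (perform m D).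
- by apply: leq_trans (perform_weight _ lt_xy Dy) _; rewrite -ltnS.
- exact: perform_shape.
exists Dp; split.
  split=> // bs ex_bs; rewrite Dp_v //.
  exact: perform_vprod (order_ideal_convex O_ideal) ex_bs _ _ _ _ O_D _ _.
apply: rt_trans D'Dp; apply: rt_step; exists m; split=> //.
  exact: rect_rectangular O_ideal Oy _ _.
split=> //.
  by apply/subsetP => z; rewrite inE => /andP[_ zy]; apply: O_ideal zy Oy.
apply/compatible_rectP => z xz zy.
by rewrite ffunE inE xz zy; apply: D_rect.
Qed.

(* Whether the last factor is 1 or s is read off from the product v: it is s
   exactly when v s < v. *)
Lemma Gamma_diagram_inj O D D' bs : lin_ext O bs ->
  Gamma_diagram O D -> Gamma_diagram O D' -> vprod D bs = vprod D' bs -> D = D'.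
Proof.
move=> ex_bs [O_D D_asc] [O_D' D'_asc].
have [_ bsO _] := ex_bs.
have key p q : rev bs = p ++ q ->
    \prod_(a <- p) factor D a = \prod_(a <- p) factor D' a ->
    {in p, D =1 D'}.
  elim/last_ind: p q => // p b IHp q; rewrite cat_rcons => def_bs.
  have Ob : b \in O by rewrite -bsO -mem_rev def_bs mem_cat mem_head orbT.
  have := bruhat_lt_coxlen (D_asc _ ex_bs _ _ _ def_bs).
  have := bruhat_lt_coxlen (D'_asc _ ex_bs _ _ _ def_bs).
  rewrite !big_rcons /=.
  move: (IHp _ def_bs).
  set u := \prod_(a <- p) factor D a; set u' := \prod_(a <- p) factor D' a.
  have eqD : D b = D' b -> (u = u' -> {in p, D =1 D'}) ->
      u * factor D b = u' * factor D' b -> {in rcons p b, D =1 D'}.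
    move=> eq_b IH; rewrite /factor eq_b => /mulIg/IH eq_p z.
    by rewrite mem_rcons inE => /orP[/eqP -> | /eq_p].
  have := O_D' b; have := O_D b; rewrite Ob.
  case Db: (D b) => [[]|] // _; case D'b: (D' b) => [[]|] // _ IH lt' lt eq_u;
    try by apply: eqD => //; rewrite Db D'b.
    (* If the symbols in b differ, one prefix product is the other times s. Both would have to
       become longer when multiplied by s, which is impossible since s is an involution. *)
    move: eq_u; rewrite /factor Db D'b mulg1 => eq_u.
    move: lt'; rewrite -eq_u -mulgA box_refl2 mulg1 => lt'.
    by have := ltn_trans lt lt'; rewrite ltnn.
  move: eq_u; rewrite /factor Db D'b mulg1 => eq_u.
  move: lt; rewrite eq_u -mulgA box_refl2 mulg1 => lt.
  by have := ltn_trans lt lt'; rewrite ltnn.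
move=> eq_v; apply/ffunP => b; have [Ob | Ob] := boolP (b \in O).
  by apply: (key (rev bs) [::]); rewrite ?cats0 // mem_rev bsO.
have := O_D b; have := O_D' b; rewrite (negPf Ob).
by case: (D b); case: (D' b).
Qed.

End Moves.

Theorem mainTheorem3 (n j : nat) (hj : 0 < j < n) :
  complete_set_of_Gamma_moves (@rectangular n j).
Proof.
split=> [m /rectangular_lt[x [y [lt_row lt_col ->]]] | O D O_ideal O_D].
  exact: rect_Gamma_move.
have [Dp [Dp_plus D_Dp]] := reach_Gamma O_ideal O_D.
exists Dp; split=> //; split=> // D' [D'_Gamma D'_v].
have [bs ex_bs] := lin_ext_ex O; have [Dp_Gamma Dp_v] := Dp_plus.
by apply: (Gamma_diagram_inj ex_bs Dp_Gamma D'_Gamma); rewrite Dp_v // D'_v.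
Qed.
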